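(* Let $k\ge1$, let $\varepsilon_1,\dots,\varepsilon_k>0$, and let $\mathcal{M}_i$ be the class of $\varepsilon_i$-bounded-range mechanisms. For $1\le\ell\le k$ let $\mathcal{A}_{\mathrm{BR}}^{\ell:k}=\{\mathrm{AdaComp}(\mathcal{A},(\mathcal{M}_\ell,\dots,\mathcal{M}_k),\cdot):\mathcal{A}\text{ an adversary}\}$ be the family of adaptive compositions using the classes $\mathcal{M}_\ell,\dots,\mathcal{M}_k$, and set $\delta_{\mathrm{opt}}(\mathcal{A}_{\mathrm{BR}}^{k+1:k},\varepsilon_g)=\max\{1-e^{\varepsilon_g},0\}$. Then for every $\varepsilon_g\in\mathbb{R}$, $$\delta_{\mathrm{opt}}(\mathcal{A}_{\mathrm{BR}}^{1:k},\varepsilon_g)=\sup_{t_1\in[0,\varepsilon_1]}\Big\{q_{\varepsilon_1,t_1}\,\delta_{\mathrm{opt}}(\mathcal{A}_{\mathrm{BR}}^{2:k},\varepsilon_g-t_1)+(1-q_{\varepsilon_1,t_1})\,\delta_{\mathrm{opt}}(\mathcal{A}_{\mathrm{BR}}^{2:k},\varepsilon_g+\varepsilon_1-t_1)\Big\},$$ where $q_{\varepsilon,t}=\frac{1-e^{t-\varepsilon}}{1-e^{-\varepsilon}}$.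
   Context: A data universe is a set $\mathcal{X}$ with a symmetric neighboring relation $x\sim x'$. A mechanism $M:\mathcal{X}\to\mathcal{Y}$ assigns to each $x$ a probability distribution of a random outcome $M(x)\in\mathcal{Y}$; $\Pr[M(x)=y]$ denotes the probability mass function, or, for continuous outcome spaces, the probability density function with respect to a common reference measure. $M$ is $\varepsilon$-bounded-range if for all neighbors $x\sim x'$ and all $y_1,y_2\in\mathcal{Y}$, $\frac{\Pr[M(x)=y_1]}{\Pr[M(x')=y_1]}\le e^{\varepsilon}\frac{\Pr[M(x)=y_2]}{\Pr[M(x')=y_2]}$ (in cross-multiplied form when probabilities vanish). Data universes (with neighboring pairs) and outcome spaces are arbitrary. $M$ is $(\varepsilon,\delta)$-DP if $\Pr[M(x)\in S]\le e^{\varepsilon}\Pr[M(x')\in S]+\delta$ for all $x\sim x'$ and all (measurable) $S\subseteq\mathcal{Y}$. For $\varepsilon_g\in\mathbb{R}$, $\delta_{\mathrm{opt}}(M,\varepsilon_g)=\inf\{\delta: M\text{ is }(\varepsilon_g,\delta)\text{-DP}\}$, and for a class $\mathcal{M}$, $\delta_{\mathrm{opt}}(\mathcal{M},\varepsilon_g)=\sup_{M\in\mathcal{M}}\delta_{\mathrm{opt}}(M,\varepsilon_g)$. Adaptive composition game: an adversary is a pair $\mathcal{A}=(\mathcal{R},\mathcal{D})$ with $\mathcal{R}$ a randomized algorithm and $\mathcal{D}$ a deterministic one. Given classes of mechanisms $(\mathcal{E}_1,\dots,\mathcal{E}_m)$ and a bit $b\in\{0,1\}$, the game $\mathrm{AdaComp}(\mathcal{A},(\mathcal{E}_1,\dots,\mathcal{E}_m),b)$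 runs: draw $r_0\sim\mathcal{R}(\emptyset)$; for $i=1,\dots,m$: $\mathcal{D}(r_0,A_1^b,r_1,\dots,A_{i-1}^b,r_{i-1})$ selects neighboring datasets $x^{i,0}\sim x^{i,1}$ and a mechanism $M_i\in\mathcal{E}_i$, the outcome $A_i^b=M_i(x^{i,b})$ is drawn with fresh randomness, and $r_i\sim\mathcal{R}(r_0,A_1^b,\dots,r_{i-1},A_i^b)$. The output is the view $(r_0,A_1^b,r_1,\dots,A_m^b,r_m)$. For a fixed adversary this is regarded as a mechanism with input $b\in\{0,1\}$, the inputs $0$ and $1$ being neighbors. *)

(* Defs.v *)
From HB Require Import structures.
From mathcomp Require Import all_boot all_order all_algebra.
From mathcomp Require Import all_classical all_reals all_analysis.
From mathcomp Require Import measurable_realfun.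

Set Implicit Arguments.
Unset Strict Implicit.
Unset Printing Implicit Defensive.
Import Order.TTheory GRing.Theory Num.Theory.
Import numFieldNormedType.Exports.

Local Open Scope classical_set_scope.
Local Open Scope ring_scope.

Record mspace := MSpace {
  mspace_display : measure_display;
  mspace_type :> measurableType mspace_display }.

(* The joint law of (x, y) when x is drawn from P and then y from k x. *)
Section joint.
Context d d' (X : measurableType d) (Y : measurableType d') (R : realType).
Variables (P : probability X R) (k : R.-pker X ~> Y).
Local Open Scope ereal_scope.

Definition joint (A : set (X * Y)) : \bar R := \int[P]_x k x (xsection A x).

Let joint0 : joint set0 = 0.
Proof.
rewrite /joint; apply: integral0_eq => x _.
by rewrite xsection0 measure0.
Qed.

Let joint_ge0 A : 0 <= joint A.
Proof. exact: integral_ge0. Qed.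

Let joint_measurable A : measurable A ->
  measurable_fun [set: X] (fun x => k x (xsection A x) : \bar R).
Proof.
move=> mA; apply: measurable_fun_xsection_finite_kernel.
by rewrite inE.
Qed.

Let joint_sigma_additive : semi_sigma_additive joint.
Proof.
move=> F mF tF mUF; rewrite [X in _ --> X](_ : _ =
    \int[P]_x (\sum_(n <oo) k x (xsection (F n) x))); last first.
  apply: eq_integral => x _; rewrite xsection_bigcup.
  apply/esym/cvg_lim => //; apply: measure_semi_sigma_additive.
  - by move=> n; exact: measurable_xsection.
  - exact: trivIset_xsection.
  - by apply: bigcup_measurable => n _; exact: measurable_xsection.
apply/cvg_closeP; split.
  by apply: is_cvg_nneseries => n _ _; exact: integral_ge0.
rewrite closeE// integral_nneseries// => n.
exact: joint_measurable.
Qed.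

HB.instance Definition _ := isMeasure.Build _ _ _ joint
  joint0 joint_ge0 joint_sigma_additive.

Let joint_setT : joint [set: X * Y] = 1.
Proof.
rewrite /joint (eq_integral (cst 1)); last first.
  move=> x _; rewrite -(@prob_kernel _ _ _ _ _ k x); congr (k x _).
  by rewrite -setXTT in_xsectionX// in_setT.
rewrite integral_cst// mul1e; exact: probability_setT.
Qed.

HB.instance Definition _ := Measure_isProbability.Build _ _ _ joint joint_setT.
End joint.

Record mechanism (R : realType) := Mechanism {
  data_universe : Type;
  neighbor : data_universe -> data_universe -> Prop;
  neighbor_sym : forall x x', neighbor x x' -> neighbor x' x;
  outcome_space : mspace;
  law : data_universe -> probability outcome_space R }.

(* The density f x is taken with respect to a reference measure mu common to
   all inputs x; for probability mass functions, mu is the counting measure.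
   If the singletons are measurable, then Pr[M(x) = y] = f x y * mu {y}, so the
   inequality for f gives the one for the probability mass functions. *)
Definition bounded_range (R : realType) (e : R) (M : mechanism R) : Prop :=
  exists (mu : {measure set (outcome_space M) -> \bar R})
         (f : data_universe M -> outcome_space M -> R),
  [/\ forall x y, 0 <= f x y,
      forall x, measurable_fun [set: outcome_space M] (f x),
      forall x A, measurable A -> law x A = (\int[mu]_(y in A) (f x y)%:E)%E &
      forall x x', neighbor x x' -> forall y1 y2,
        f x y1 * f x' y2 <= expR e * (f x y2 * f x' y1)].

Definition is_dp (R : realType) (e d : R) (M : mechanism R) : Prop :=
  forall x x' : data_universe M, neighbor x x' ->
  forall S : set (outcome_space M), measurable S ->
  (law x S <= (expR e)%:E * law x' S + d%:E)%E.

Definition delta_opt (R : realType) (M : mechanism R) (eg : R) : \bar R :=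
  ereal_inf [set d%:E | d in [set d : R | is_dp eg d M]].

(* Universe levels rule out set (mechanism R) and the notations for it. *)
Definition mechanism_class (R : realType) := mechanism R -> Prop.

Definition delta_opt_class (R : realType) (C : mechanism_class R) (eg : R) :
    \bar R :=
  ereal_sup [set d | exists2 M : mechanism R, C M & delta_opt M eg = d].

(* What D selects in one round. The mechanism, and with it the outcome space,
   may depend on the history. For the views to live in one measurable space,
   the outcome is recorded through an isomorphism, encode, from the outcome
   space onto a subspace of a space Y that depends on the round only. *)
Record query (R : realType) (Y : mspace) := Query {
  query_mech : mechanism R;
  query_data : bool -> data_universe query_mech;
  query_neighbor : neighbor (query_data false) (query_data true);
  encode : {mfun outcome_space query_mech >-> Y};
  encode_inj : injective encode;
  encode_measurable : forall A : set (outcome_space query_mech),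
    measurable A -> exists2 B : set Y, measurable B & A = encode @^-1` B }.

Definition answer (R : realType) (Y : mspace) (q : query R Y) (b : bool) :
    probability Y R :=
  distribution (law (query_data q b)) (encode q).

(* history Rsp Asp i contains (r_0, A_1, r_1, ..., A_i, r_i), where r_i is in
   Rsp i and A_(i+1) is in Asp i. *)
Fixpoint history (Rsp Asp : nat -> mspace) (i : nat) : mspace :=
  match i with
  | 0 => Rsp 0
  | j.+1 => MSpace ((history Rsp Asp j * Asp j) * Rsp j.+1)%type
  end.

(* The fields adv_init and adv_next are the randomized algorithm; adv_select i
   is the deterministic one in round i + 1. It is defined for all i, and a game
   of m rounds uses it for i < m only. Without adv_measurable the law of the
   view would not be defined. *)
Record adversary (R : realType) := Adversary {
  adv_rand : nat -> mspace;
  adv_out : nat -> mspace;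
  adv_init : probability (adv_rand 0) R;
  adv_next : forall i, R.-pker (history adv_rand adv_out i * adv_out i)
                        ~> adv_rand i.+1;
  adv_select : forall i, history adv_rand adv_out i -> query R (adv_out i);
  adv_measurable : forall i b, measurable_fun [set: history adv_rand adv_out i]
    (fun h => answer (adv_select h) b : pprobability (adv_out i) R) }.
Arguments adv_measurable {R} a i b.

Definition view (R : realType) (A : adversary R) (i : nat) : mspace :=
  history (adv_rand A) (adv_out A) i.

Fixpoint view_law (R : realType) (A : adversary R) (b : bool) (i : nat) :
    probability (view A i) R :=
  match i return probability (view A i) R with
  | 0 => adv_init A
  | j.+1 => joint (joint (view_law A b j) (kprobability (adv_measurable A j b)))
                  (adv_next A j)
  end.

Lemma bit_neighbor_sym (b b' : bool) : b != b' -> b' != b.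
Proof. by rewrite eq_sym. Qed.

Definition AdaComp (R : realType) (A : adversary R) (m : nat) : mechanism R :=
  Mechanism bit_neighbor_sym (fun b => view_law A b m).

Definition plays_in (R : realType) (m : nat) (E : 'I_m -> mechanism_class R)
    (A : adversary R) : Prop :=
  forall (i : 'I_m) (h : view A i), E i (query_mech (adv_select h)).

Definition AdaComp_family (R : realType) (m : nat)
    (E : 'I_m -> mechanism_class R) : mechanism_class R :=
  fun M => exists2 A : adversary R, plays_in E A & AdaComp A m = M.

(* The classes indexed by l, l + 1, ..., k. *)
Definition BR_family (R : realType) (eps : nat -> R) (l k : nat) :
    mechanism_class R :=
  AdaComp_family (fun i : 'I_(k.+1 - l) => bounded_range (eps (l + i)%N)).

Definition delta_BR (R : realType) (eps : nat -> R) (l k : nat) (eg : R) :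
    \bar R :=
  if (l <= k)%N then delta_opt_class (BR_family eps l k) eg
  else (Num.max (1 - expR eg) 0)%:E.

Definition q_br (R : realType) (e t : R) : R :=
  (1 - expR (t - e)) / (1 - expR (- e)).

(* Main.v *)
(* Fix an event S on the full view and condition on r_0 and A_1 = a. If u(a)
   and v(a) are the probabilities of S under b = 0 and b = 1, then
   u - e^y v <= delta(y) for every y, where delta(y) is the optimal delta of the
   remaining rounds. By bounded range, the likelihood ratio between the two laws
   P, Q of A_1 lies in [e^(t - eps_1), e^t] for some t in [0, eps_1]: P and Q are
   mixtures of two measures on which the ratio is one of the two end points, and
   q_br eps_1 t is the mass of P on the part where it is e^t. Averaging the bounds
   at y = eg - t and y = eg + eps_1 - t gives "<=". The bound is approached when the
   first mechanism is the randomized response with these two ratios and a nearly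
   optimal adversary for the corresponding y plays after each response. *)
From HB Require Import structures.
Require Import Defs.
From mathcomp Require Import all_boot all_order all_algebra.
From mathcomp Require Import all_classical all_reals all_analysis.
From mathcomp Require Import measurable_realfun.
From mathcomp Require Import ring lra.

Set Implicit Arguments.
Unset Strict Implicit.
Unset Printing Implicit Defensive.
Import Order.TTheory GRing.Theory Num.Theory.
Import numFieldNormedType.Exports.

Local Open Scope classical_set_scope.
Local Open Scope ring_scope.
Local Open Scope ereal_scope.

(** * Kernels and joint laws *)

Section pprobability_kernels.
Context d d' (X : measurableType d) (Y : measurableType d') (R : realType).

(** The sigma-algebra on laws is generated by the sets of laws that give a measurable set a
    probability below a threshold, so evaluations decide measurability. The laws built for the mixed
    game are checked this way. *)
Lemma measurable_fun_pprobability (P : X -> pprobability Y R) :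
  (forall U, measurable U -> measurable_fun [set: X] (P ^~ U : X -> \bar R)) ->
  measurable_fun [set: X] P.
Proof.
move=> mP; apply: (measurability (@pset _ _ _ : set (set (pprobability Y R)))) => //.
move=> _ -[_ [r r01] [U mU <-]] <-.
by apply: emeasurable_fun_infty_o => //; exact: mP.
Qed.

Lemma measurable_pprobability_eval (P : X -> pprobability Y R) U :
  measurable_fun [set: X] P -> measurable U ->
  measurable_fun [set: X] (P ^~ U : X -> \bar R).
Proof. by move=> mP mU; exact: (measurable_kernel (kprobability mP)). Qed.

(** A name for [k x] on which the probability structure can be declared, so that it can be pushed
    forward or serve as the initial law of a game. *)
Definition kernel_law (k : R.-pker X ~> Y) (x : X) : set Y -> \bar R := k x.

HB.instance Definition _ k x := Measure.on (kernel_law k x).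
HB.instance Definition _ (k : R.-pker X ~> Y) x :=
  Measure_isProbability.Build _ _ _ (kernel_law k x) (@prob_kernel _ _ _ _ _ k x).

Lemma measurable_kernel_law (k : R.-pker X ~> Y) :
  measurable_fun [set: X] (fun x => kernel_law k x : pprobability Y R).
Proof.
by apply: measurable_fun_pprobability => U mU; exact: measurable_kernel.
Qed.

(** The branches form a family indexed by the bit because, in the mixed game, the types occurring
    inside [F b] depend on [b]. *)
Lemma measurable_fun_bool_case (g : X -> bool) (F : bool -> X -> Y) :
  measurable_fun [set: X] g -> (forall b, measurable_fun [set: X] (F b)) ->
  measurable_fun [set: X] (fun x => F (g x) x).
Proof.
move=> mg mF; rewrite (_ : (fun x => _) =
  (fun x => if g x then F true x else F false x)).
  exact: measurable_fun_ifT.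
by apply/funext => x; case: (g x).
Qed.

End pprobability_kernels.

Section pushforward_probability.
Context d d' d'' (X : measurableType d) (Y : measurableType d')
  (Z : measurableType d'') (R : realType).

(** The preimage of [U] under the uncurried [f] is measurable in the product, its section at [x] is
    the preimage under [f x], and the mass that a kernel gives to sections is measurable. *)
Lemma measurable_fun_distribution (P : X -> pprobability Y R)
    (f : X -> {mfun Y >-> Z}) :
  measurable_fun [set: X] P ->
  measurable_fun [set: X * Y] (fun p => f p.1 p.2) ->
  measurable_fun [set: X] (fun x => distribution (P x) (f x) : pprobability Z R).
Proof.
move=> mP mf; apply: measurable_fun_pprobability => U mU.
have mfU : measurable ((fun p : X * Y => f p.1 p.2) @^-1` U).
  by rewrite -[X in measurable X]setTI; exact: mf.
rewrite (_ : (fun x => _) = (fun x => kprobability mP x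
    (xsection ((fun p : X * Y => f p.1 p.2) @^-1` U) x))).
  by apply: measurable_fun_xsection_finite_kernel; rewrite inE.
apply/funext => x; rewrite /= /distribution /pushforward /kprobability/=.
by congr (P x _); apply/seteqP; split => y; rewrite /xsection/= inE.
Qed.

End pushforward_probability.

Section integral_joint.
Context d d' (X : measurableType d) (Y : measurableType d') (R : realType).
Variables (P : probability X R) (k : R.-pker X ~> Y).

Lemma measurable_pair (x : X) : measurable_fun [set: Y] (pair x).
Proof. exact: measurable_fun_pair. Qed.

HB.instance Definition _ x := isMeasurableFun.Build _ _ _ _ (pair x) (measurable_pair x).

Let kP (_ : unit) : pprobability X R := P.
Let mkP : measurable_fun [set: unit] kP. Proof. exact: measurable_cst. Qed.

Let kpair (p : unit * X) : pprobability (X * Y)%type R :=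
  distribution (kernel_law k p.2) (pair p.2).
Let mkpair : measurable_fun [set: unit * X] kpair.
Proof.
apply: (@measurable_fun_distribution _ _ _ _ _ _ _
  (fun p : unit * X => kernel_law k p.2) (fun p => pair p.2)).
  exact: measurableT_comp (measurable_kernel_law k) _.
apply: measurable_fun_pair => //=.
exact: measurableT_comp measurable_snd measurable_fst.
Qed.

(** [joint P k] is a composition of kernels: from [unit], draw [x] by [P]; from [x], draw the pair
    [(x, y)]. The integral formula for composed kernels then applies. *)
Lemma integral_joint (g : X * Y -> \bar R) :
  (forall p, 0 <= g p) -> measurable_fun [set: X * Y] g ->
  \int[joint P k]_p g p = \int[P]_x \int[k x]_y g (x, y).
Proof.
move=> g0 mg.
have := integral_kcomp (kprobability mkP) (kprobability mkpair) tt g0 mg.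
rewrite /= /kprobability /kP/= => e; transitivity (\int[kcomp
    (kprobability mkP) (kprobability mkpair) tt]_z g z).
  apply: eq_measure_integral => A mA _; rewrite /kcomp /joint.
  apply: eq_integral => x _; rewrite /kprobability/= /distribution /pushforward.
  congr (k x _); apply/seteqP; split => y; rewrite /xsection/= inE//.
rewrite e; apply: eq_integral => x _.
by rewrite ge0_integral_distribution.
Qed.

End integral_joint.

(** * Likelihood ratios of bounded-range mechanisms *)

Section likelihood_ratio.
Context (R : realType).

(** [t] is the logarithm of the supremum of [f x y / f x' y]. Bounded range keeps every ratio within
    a factor [expR e] of this supremum. Integrating the two pointwise bounds compares the laws, and
    on the whole space they force [0 <= t <= e]. *)
Lemma bounded_range_ratio (M : mechanism R) (e : R) (x x' : data_universe M) :
  bounded_range e M -> neighbor x x' ->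
  exists2 t : R, (0 <= t <= e)%R & forall A, measurable A ->
    (expR (- t))%:E * law x A <= law x' A /\
    law x' A <= (expR (e - t))%:E * law x A.
Proof.
move=> [mu [f [f0 mf lawE fle]]] xx'.
have lawZ z (A : set (outcome_space M)) (c : R) : measurable A -> (0 <= c)%R ->
    c%:E * law z A = \int[mu]_(y in A) (c * f z y)%:E.
  move=> mA c0; rewrite lawE// -ge0_integralZl_EFin//.
  - by move=> y _; rewrite lee_fin.
  - by apply/measurable_EFinP; exact: measurable_funS (mf z).
have law_le z z' (c : R) : (0 <= c)%R -> (forall y, f z y <= c * f z' y)%R ->
    forall A, measurable A -> law z A <= c%:E * law z' A.
  move=> c0 fc A mA; rewrite lawZ// lawE//; apply: ge0_le_integral => //.
  - by move=> y _; rewrite lee_fin.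
  - by apply/measurable_EFinP; exact: measurable_funS (mf z).
  - apply/measurable_EFinP/measurable_funM => //.
    exact: measurable_funS (mf z').
  - by move=> y _; rewrite lee_fin.
have f_pos z : exists y, (0 < f z y)%R.
  apply: contrapT => /forallNP fz0.
  have := probability_setT (law z); rewrite lawE// integral0_eq.
    by move/eqP; rewrite eq_sym onee_eq0.
  move=> y _; congr EFin; apply/eqP; rewrite eq_le f0 andbT leNgt.
  exact/negP.
have [y0 y0_gt0] := f_pos x; have [y1 y1_gt0] := f_pos x'.
(* Comparison with [y1], where [f x'] is positive, shows that the quotients on the support of [f x']
   miss no part of [f x]. *)
have f0_of y : f x' y = 0%R -> f x y = 0%R.
  move=> fy; have := fle _ _ xx' y y1; rewrite fy mulr0 mulr0 => h.
  apply/eqP; rewrite eq_le f0 andbT -(pmulr_lle0 _ y1_gt0) //.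
have f'_ge0 y : f x' y = 0%R \/ (0 < f x' y)%R.
  by have [->|fy] := eqVneq (f x' y) 0%R; [left|right; rewrite lt0r fy f0].
pose T := [set (f x y / f x' y)%R | y in [set y | (0 < f x' y)%R]].
have T_ub y : (0 < f x' y)%R -> ubound T (expR e * (f x y / f x' y))%R.
  move=> fy _ [w /= fw <-]; rewrite ler_pdivrMr// mulrA mulrAC.
  by rewrite ler_pdivlMr// -mulrA; exact: fle.
have supT y : (0 < f x' y)%R -> (f x y / f x' y <= sup T)%R.
  move=> fy; apply: ub_le_sup; last by exists y.
  by exists (expR e * (f x y1 / f x' y1))%R; exact: T_ub.
have le_sup y : (f x y <= sup T * f x' y)%R.
  have [fy|fy] := f'_ge0 y; first by rewrite f0_of fy// mulr0.
  by rewrite -ler_pdivrMr//; exact: supT.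
have sup_le y : (sup T * f x' y <= expR e * f x y)%R.
  have [fy|fy] := f'_ge0 y; first by rewrite f0_of fy// !mulr0.
  rewrite -ler_pdivlMr// -mulrA; apply: ge_sup; last exact: T_ub.
  by exists (f x y / f x' y)%R, y.
have sup_ge0 : (0 <= sup T)%R.
  by apply: le_trans (supT _ y1_gt0); rewrite divr_ge0.
have law_le_sup := law_le _ _ _ sup_ge0 le_sup.
have sup_ge1 : (1 <= sup T)%R.
  by have := law_le_sup setT measurableT; rewrite !probability_setT mule1 lee_fin.
have sup_gt0 : (0 < sup T)%R by exact: lt_le_trans sup_ge1.
have sup_law_le : forall A, measurable A ->
    law x' A <= (expR e / sup T)%:E * law x A.
  apply: law_le => [|y]; first by rewrite divr_ge0// expR_ge0.
  by rewrite mulrAC ler_pdivlMr// mulrC.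
exists (ln (sup T)).
  rewrite ln_ge0//= -ler_expR lnK ?posrE//.
  have := sup_law_le setT measurableT; rewrite !probability_setT mule1 lee_fin.
  by rewrite ler_pdivlMr// mul1r.
move=> A mA; rewrite expRN expRD expRN lnK ?posrE//; split; last exact: sup_law_le.
have := law_le_sup A mA; rewrite -(@lee_pmul2l _ (sup T)^-1%:E)//; last first.
  by rewrite lte_fin invr_gt0.
by rewrite muleA -EFinM mulVf ?mul1e// gt_eqF.
Qed.

End likelihood_ratio.

(** * Integrals of functions with values in the unit interval *)

Section unit_interval_functions.
Context d (Y : measurableType d) (R : realType) (P : probability Y R).
Variable v : Y -> R.
Hypotheses (mv : measurable_fun [set: Y] v) (v01 : forall y, (0 <= v y <= 1)%R).

Lemma integrable_unit_interval : P.-integrable [set: Y] (EFin \o v).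
Proof.
apply: measurable_bounded_integrable => //.
  by rewrite [X in X < _]probability_setT ltry.
exists 1%R; split=> // c c1 y _; have /andP[w0 w1] := v01 y.
by rewrite /= ger0_norm// (le_trans w1)// ltW.
Qed.

Let integrable_scale b : P.-integrable [set: Y] (EFin \o (fun y => b * v y)%R).
Proof. by apply: eq_integrable (integrableZl _ b integrable_unit_interval). Qed.

Let integrable_cst c : P.-integrable [set: Y] (EFin \o (fun=> c)).
Proof.
apply: measurable_bounded_integrable => //.
  by rewrite [X in X < _]probability_setT ltry.
by exists `|c|%R; split=> // a ca y _; rewrite /= ltW.
Qed.

Lemma integrable_affine c b :
  P.-integrable [set: Y] (EFin \o (fun y => c + b * v y)%R).
Proof.
by apply: eq_integrable (integrableD _ (integrable_cst c) (integrable_scale b)).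
Qed.

Lemma Rintegral_affine c b :
  (\int[P]_y (c + b * v y) = c + b * \int[P]_y v y)%R.
Proof.
rewrite RintegralD// RintegralZl//; last exact: integrable_unit_interval.
rewrite [X in (X + _)%R]Rintegral_cst//.
by rewrite -[X in fine X]/(P setT) probability_setT/= mulr1.
Qed.

Lemma Rintegral_unit_interval : (0 <= \int[P]_y v y <= 1)%R.
Proof.
rewrite Rintegral_ge0/=; last by move=> y _; have /andP[] := v01 y.
(* The constant 1 is read as affine in [v] with slope 0, so that [Rintegral_affine] integrates
   it. *)
have -> : 1%R = (\int[P]_y (1 + 0 * v y))%R :> R.
  by rewrite Rintegral_affine mul0r addr0.
apply: le_Rintegral => //; [exact: integrable_unit_interval|exact: integrable_affine|].
by move=> y _; rewrite mul0r addr0; have /andP[] := v01 y.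
Qed.

End unit_interval_functions.

Section two_point.
Context d (Y : measurableType d) (R : realType) (P Q : probability Y R).
Variables (z0 z1 : R).
Hypotheses (z01 : (z0 < z1)%R) (z0_ge0 : (0 <= z0)%R).
Hypothesis PQ : forall A, measurable A ->
  z0%:E * P A <= Q A /\ Q A <= z1%:E * P A.

(** [PQ] compares [Q] with multiples of [P] as measures, and integrals of nonnegative functions are
    monotone in the measure. *)
Let integral_ratio (h : Y -> R) : measurable_fun [set: Y] h ->
  (forall y, 0 <= h y)%R ->
  z0%:E * \int[P]_y (h y)%:E <= \int[Q]_y (h y)%:E /\
  \int[Q]_y (h y)%:E <= z1%:E * \int[P]_y (h y)%:E.
Proof.
move=> mh h0.
have z1_ge0 : (0 <= z1)%R by rewrite (le_trans z0_ge0)// ltW.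
have mh' : measurable_fun [set: Y] (EFin \o h) by exact/measurable_EFinP.
have scale (c : R) (c0 : (0 <= c)%R) : c%:E * \int[P]_y (h y)%:E =
    \int[mscale (NngNum c0) P]_y (h y)%:E.
  by rewrite ge0_integral_mscale// => y _; rewrite lee_fin.
by rewrite (scale _ z0_ge0) (scale _ z1_ge0); split;
  apply: ge0_le_measure_integral => //= A mA;
  case: (PQ mA).
Qed.

(* With h0 and h1 the slacks of the two hypotheses on u, add
   [z1 \int h0 dP >= \int h0 dQ] and [\int h1 dQ >= z0 \int h1 dP]; the
   integrals of [u 0] against Q and of [u 1] against P cancel. *)
Lemma two_point_bound (u v : Y -> R) (E V0 V1 : R) :
  measurable_fun [set: Y] u -> measurable_fun [set: Y] v ->
  (forall y, 0 <= u y <= 1)%R -> (forall y, 0 <= v y <= 1)%R ->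
  (forall y, u y <= V0 + E * z0 * v y)%R ->
  (forall y, u y <= V1 + E * z1 * v y)%R ->
  (\int[P]_y u y <=
   ((z1 - 1) * V0 + (1 - z0) * V1) / (z1 - z0) + E * \int[Q]_y v y)%R.
Proof.
move=> mu mv u01 v01 uV0 uV1.
have slackE (S : probability Y R) (c b : R) :
    (\int[S]_y (c + b * v y - u y)%:E = (c + b * \int[S]_y v y - \int[S]_y u y)%:E)%E.
  have iu := integrable_unit_interval S mu u01.
  have icbv := integrable_affine S mv v01 c b.
  rewrite -[LHS]fineK.
    by congr EFin; rewrite [LHS]RintegralB// Rintegral_affine.
  by apply: integrable_fin_num => //; apply: eq_integrable (integrableB _ icbv iu).
have mslack (c b : R) : measurable_fun [set: Y] (fun y => c + b * v y - u y)%R.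
  by apply: measurable_funB => //; apply: measurable_funD => //; exact: measurable_funM.
have [|_] := integral_ratio (mslack V0 (E * z0)%R); first by move=> y; rewrite subr_ge0.
have [|+ _] := integral_ratio (mslack V1 (E * z1)%R); first by move=> y; rewrite subr_ge0.
rewrite !slackE -!EFinM !lee_fin => h1 h0.
rewrite -lerBlDr ler_pdivlMr ?subr_gt0//.
have := lerD h0 h1; rewrite -subr_ge0 => slack_ge0.
rewrite -subr_ge0; apply: le_trans slack_ge0 _.
by rewrite le_eqVlt; apply/orP; left; apply/eqP; ring.
Qed.

End two_point.

(** * Games and their first round *)

Section expectation.
Context (R : realType).
Implicit Types (A : adversary R) (b : bool).

Definition round_mean A b j (g : view A j.+1 -> \bar R) (h : view A j) : \bar R :=
  \int[answer (adv_select h) b]_a \int[adv_next A j (h, a)]_r g ((h, a), r).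

(* The last round is integrated out first, so that the first round can be peeled
   off by induction without any measurability side condition. *)
Fixpoint expect A b m : (view A m -> \bar R) -> \bar R :=
  match m return (view A m -> \bar R) -> \bar R with
  | 0 => fun g => \int[adv_init A]_h g h
  | j.+1 => fun g => expect b (round_mean b g)
  end.

Lemma round_mean_ge0 A b j (g : view A j.+1 -> \bar R) :
  (forall h, 0 <= g h) -> forall h, 0 <= round_mean b g h.
Proof. by move=> g0 h; do 2 (apply: integral_ge0 => ? _). Qed.

Lemma measurable_next_mean A j (g : view A j.+1 -> \bar R) :
  (forall h, 0 <= g h) -> measurable_fun [set: view A j.+1] g ->
  measurable_fun [set: view A j * adv_out A j]
    (fun p => \int[adv_next A j p]_r g (p, r)).
Proof. by move=> g0 mg; exact: measurable_fun_integral_finite_kernel. Qed.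

Lemma measurable_round_mean A b j (g : view A j.+1 -> \bar R) :
  (forall h, 0 <= g h) -> measurable_fun [set: view A j.+1] g ->
  measurable_fun [set: view A j] (round_mean b g).
Proof.
move=> g0 mg.
apply: (measurable_fun_integral_finite_kernel
  (fun p => \int[adv_next A j p]_r g (p, r))
  (kprobability (adv_measurable A j b))).
- by move=> p; apply: integral_ge0.
- exact: measurable_next_mean.
Qed.

(** A round is two nested [joint]s: the first use of [integral_joint] splits off the random string,
    the second the answer, leaving [round_mean] over the shorter view. *)
Lemma integral_view_law A b m (g : view A m -> \bar R) :
  (forall h, 0 <= g h) -> measurable_fun [set: view A m] g ->
  \int[view_law A b m]_h g h = expect b g.
Proof.
elim: m g => [//|m IH] g g0 mg.
rewrite /= integral_joint// integral_joint; last 2 first.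
- by move=> p; apply: integral_ge0.
- exact: measurable_next_mean.
by rewrite -IH//; [exact: round_mean_ge0|exact: measurable_round_mean].
Qed.

Lemma view_law_expect A b m (S : set (view A m)) : measurable S ->
  view_law A b m S = expect b (fun h => (\1_S h)%:E).
Proof.
move=> mS; rewrite -integral_view_law ?integral_indic ?setIT//.
by apply/measurable_EFinP; exact: measurable_indic.
Qed.

End expectation.

(** * Exchanging the two inputs *)

Section swap.
Context (R : realType).

Definition query_swap (Y : mspace) (q : query R Y) : query R Y :=
  @Query R Y (query_mech q) (fun b => query_data q (~~ b))
    (neighbor_sym (query_neighbor q)) (encode q)
    (@encode_inj _ _ q) (@encode_measurable _ _ q).

(** Privacy is required for both orders of the inputs. Exchanging the datasets of every query turns
    one order into the other and keeps the mechanisms, so it suffices to study one order over all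
    adversaries. *)
Definition swap (A : adversary R) : adversary R :=
  @Adversary R (adv_rand A) (adv_out A) (adv_init A) (adv_next A)
    (fun i h => query_swap (adv_select h))
    (fun i b => adv_measurable A i (~~ b)).

Lemma expect_swap A b m (g : view A m -> \bar R) :
  @expect R (swap A) b m g = expect (~~ b) g.
Proof. by elim: m g => [//|m IH] g; exact: IH. Qed.

Lemma view_law_swap A b m (S : set (view A m)) : measurable S ->
  view_law (swap A) b m S = view_law A (~~ b) m S.
Proof. by move=> mS; rewrite !view_law_expect//; exact: expect_swap. Qed.

End swap.

(** * The game left after the first answer *)

Section remaining_game.
Context (R : realType) (A : adversary R).
Variable p : (view A 0 * adv_out A 0)%type.

Let rand i := adv_rand A i.+1.
Let out i := adv_out A i.+1.

Fixpoint extend i : history rand out i -> view A i.+1 :=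
  match i return history rand out i -> view A i.+1 with
  | 0 => fun r => (p, r)
  | j.+1 => fun h => ((extend h.1.1, h.1.2), h.2)
  end.

Lemma measurable_extend i : measurable_fun [set: history rand out i] (@extend i).
Proof.
elim: i => [|i IH] /=; first exact: measurable_fun_pair.
apply: measurable_fun_pair => //; apply: measurable_fun_pair.
- exact: measurableT_comp IH (measurableT_comp measurable_fst measurable_fst).
- exact: measurableT_comp measurable_snd measurable_fst.
Qed.

Let extend_out i (x : (history rand out i * out i)%type) :
  (view A i.+1 * adv_out A i.+1)%type := (extend x.1, x.2).

Let measurable_extend_out i :
  measurable_fun [set: history rand out i * out i] (@extend_out i).
Proof.
by apply: measurable_fun_pair => //; exact: measurableT_comp (@measurable_extend i) _.
Qed.

Let next i (x : (history rand out i * out i)%type) : pprobability (rand i.+1) R :=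
  kernel_law (adv_next A i.+1) (extend_out x).

Let measurable_next i : measurable_fun [set: history rand out i * out i] (@next i).
Proof. exact: measurableT_comp (measurable_kernel_law _) (@measurable_extend_out i). Qed.

Let measurable_select i b : measurable_fun [set: history rand out i]
  (fun h => answer (adv_select (extend h)) b : pprobability (out i) R).
Proof. exact: measurableT_comp (adv_measurable A i.+1 b) (@measurable_extend i). Qed.

(** The string [r_1] becomes the initial randomness, and all later choices are those of [A] on the
    history with [p] put in front. *)
Definition remaining : adversary R :=
  @Adversary R rand out (kernel_law (adv_next A 0) p)
    (fun i => kprobability (@measurable_next i))
    (fun i h => adv_select (extend h)) measurable_select.

End remaining_game.

Section first_round.
Context (R : realType) (A : adversary R) (b : bool).

Definition remaining_expect m (g : view A m.+1 -> \bar R)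
    (p : (view A 0 * adv_out A 0)%type) : \bar R :=
  @expect R (remaining p) b m (g \o @extend R A p m).

(** The full game and the remaining game integrate out their common last round in the same way, by
    conversion, so the induction only replaces [g] by its [round_mean]. *)
Lemma expect_first_round m (g : view A m.+1 -> \bar R) :
  expect b g = \int[adv_init A]_r \int[answer (adv_select (r : view A 0)) b]_a
    remaining_expect g (r, a).
Proof. by elim: m g => [//|m IH] g; exact: IH. Qed.

Lemma measurable_remaining_expect m (g : view A m.+1 -> \bar R) :
  (forall h, 0 <= g h) -> measurable_fun [set: view A m.+1] g ->
  measurable_fun [set: view A 0 * adv_out A 0] (remaining_expect g).
Proof.
elim: m g => [|m IH] g g0 mg; first exact: measurable_next_mean.
by apply: (IH (round_mean b g)); [exact: round_mean_ge0|exact: measurable_round_mean].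
Qed.

End first_round.

(** * Optimal delta as a supremum of gains *)

Section randomized_response.
Context (R : realType).

Definition bool_space : mspace := @MSpace _ bool.
Definition unit_space : mspace := @MSpace _ unit.

Definition randomized_response (p : bool -> R) : mechanism R :=
  @Mechanism R bool (fun b b' => b != b') bit_neighbor_sym bool_space
    (fun b => bernoulli_prob (p b)).

Definition response_query (p : bool -> R) : query R bool_space :=
  @Query R bool_space (randomized_response p) id isT
    (mfun_Sub (mem_set (@measurable_id _ bool setT))) (fun _ _ => id)
    (fun A mA => ex_intro2 _ _ A mA erefl).

(** The two inequalities treat distinct responses; for equal responses [1 <= expR e] is enough. *)
Lemma bounded_range_response (p : bool -> R) (e : R) :
  (forall b, 0 <= p b <= 1)%R ->
  (forall b, p b * (1 - p (~~ b)) <= expR e * ((1 - p b) * p (~~ b)))%R ->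
  (forall b, (1 - p b) * p (~~ b) <= expR e * (p b * (1 - p (~~ b))))%R ->
  (0 <= e)%R ->
  bounded_range e (randomized_response p).
Proof.
move=> p01 le1 le2 e0.
(* The reference measure is the fair coin, with mass 1/2 on each response; the factor 2 compensates
   for it. *)
pose f b (y : bool) : R := (2 * if y then p b else 1 - p b)%R.
have f0 b y : (0 <= f b y)%R.
  by have /andP[? ?] := p01 b; rewrite /f; case: y; rewrite mulr_ge0// subr_ge0.
exists (bernoulli_prob 2^-1), f; split=> //.
- move=> b A mA; rewrite integral_mkcond integral_bernoulli_prob//.
  + rewrite /randomized_response/= bernoulli_probE// !diracE /= !patchE.
    rewrite /f /unstable.onem. 
    by case: ifP => _; case: ifP => _ /=; rewrite ?mule0 ?mule1 ?adde0 ?add0e//;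
      rewrite -?EFinM -?EFinD; congr EFin; field.
  + lra.
  + by move=> y; rewrite patchE; case: ifP => //; rewrite lee_fin.
- move=> b b' bb' y1 y2; rewrite /f.
  have -> : b' = ~~ b by case: b b' bb' => [] [].
  have e1 : (1 <= expR e)%R by rewrite -expR0 ler_expR.
  have same (c : bool -> R) : (forall b, 0 <= c b)%R ->
      (2 * c b * (2 * c (~~ b)) <= expR e * (2 * c b * (2 * c (~~ b))))%R.
    by move=> c0; rewrite ler_peMl// !mulr_ge0.
  have := le1 b; have := le2 b.
  case: y1; case: y2 => h1 h2.
  + by apply: same => c; have /andP[] := p01 c.
  + by move: h1 h2; clear; lra.
  + by move: h1 h2; clear; lra.
  + by apply: (same (fun b => 1 - p b)%R) => c; rewrite subr_ge0; have /andP[] := p01 c.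
Qed.
End randomized_response.

Section gain.
Context (R : realType).
Implicit Types (A : adversary R).

Definition prob_view A b m (S : set (view A m)) : R := fine (view_law A b m S).

(** The supremum over events [S] is the hockey-stick divergence of order [expR x] between the two
    view laws. *)
Definition gain A m (x : R) (S : set (view A m)) : R :=
  (prob_view false S - expR x * prob_view true S)%R.

Lemma prob_viewE A b m (S : set (view A m)) : measurable S ->
  view_law A b m S = (prob_view b S)%:E.
Proof. by move=> mS; rewrite fineK// fin_num_measure. Qed.

Lemma prob_view01 A b m (S : set (view A m)) : measurable S ->
  (0 <= prob_view b S <= 1)%R.
Proof.
by move=> mS; rewrite -!lee_fin -prob_viewE// measure_ge0 probability_le1.
Qed.

Lemma prob_view_swap A b m (S : set (view A m)) : measurable S ->
  @prob_view (swap A) b m S = prob_view (~~ b) S.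
Proof. by move=> mS; rewrite /prob_view view_law_swap. Qed.

Lemma gain_le1 A m (x : R) (S : set (view A m)) : measurable S ->
  (gain x S <= 1)%R.
Proof.
move=> mS; have /andP[_ p1] := prob_view01 false mS.
have /andP[q0 _] := prob_view01 true mS.
by rewrite (le_trans _ p1)// gerBl mulr_ge0// expR_ge0.
Qed.

Lemma is_dp_gain A m (x c : R) : is_dp x c (AdaComp A m) <->
  forall S : set (view A m), measurable S ->
  (gain x S <= c)%R /\ (@gain (swap A) m x S <= c)%R.
Proof.
rewrite /gain; split=> [dp S mS|le_c].
  rewrite !prob_view_swap//= !lerBlDl -!lee_fin !EFinD !EFinM -!prob_viewE//.
  by split; [exact: (dp false true)|exact: (dp true false)].
move=> b b' bb' S mS; rewrite /= !prob_viewE// -EFinM -EFinD lee_fin -lerBlDl.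
have [] := le_c S mS; rewrite !prob_view_swap//.
by case: b b' bb' => [] [].
Qed.

(** Shows that the families of games are inhabited: its gain on the empty event bounds [delta_BR]
    below by 0, and its game of no rounds attains both terms of the boundary value. *)
Definition trivial_adversary : adversary R :=
  @Adversary R (fun=> unit_space) (fun=> bool_space) (\d_tt : probability unit R)
    (fun i => kdirac (@measurable_cst _ _ _ unit setT tt))
    (fun i _ => response_query (fun=> 0%R)) (fun i b => measurable_cst _).

End gain.

Section delta_BR_gain.
Context (R : realType) (eps : nat -> R) (l k m : nat).
Hypothesis klm : (k.+1 - l)%N = m.

(** The number of rounds is a variable [m] tied to [k.+1 - l] by an equation, so that views of [m]
    and [m.+1] rounds fit together without casts. The case [m = 0] covers the boundary value. *)
Definition plays_BR := plays_in (fun i : 'I_m => bounded_range (eps (l + i)%N)).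

Lemma gain_le_delta_BR (A : adversary R) (x : R) (S : set (view A m)) :
  plays_BR A -> measurable S -> (gain x S)%:E <= delta_BR eps l k x.
Proof.
rewrite /plays_BR /delta_BR; case: ifPn => [_|kl] playsA mS.
  subst m; apply: (@le_trans _ _ (delta_opt (AdaComp A (k.+1 - l)) x)).
    by apply: le_ereal_inf_tmp => _ [d /is_dp_gain/(_ S mS)[+ _] <-]; rewrite lee_fin.
  by apply: ereal_sup_ubound; exists (AdaComp A (k.+1 - l)) => //; exists A.
have m0 : m = 0%N by rewrite -klm; apply/eqP; rewrite subn_eq0 ltnNge.
clear klm playsA; subst m.
(* Before any round the view is [r_0], whose law does not depend on the bit. *)
have -> : gain x S = ((1 - expR x) * prob_view false S)%R by rewrite mulrBl mul1r.
have /andP[p0 p1] := prob_view01 false mS.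
rewrite lee_fin le_max; have [x1|x1] := lerP 0%R (1 - expR x)%R.
  by rewrite ler_piMr.
by rewrite mulr_le0_ge0 ?orbT// ltW.
Qed.

Lemma delta_BR_le (x c : R) :
  (forall A, plays_BR A -> forall S : set (view A m), measurable S ->
    (gain x S <= c)%R) -> delta_BR eps l k x <= c%:E.
Proof.
rewrite /plays_BR /delta_BR; case: ifPn => [_|kl] le_c.
  subst m; apply: ge_ereal_sup => _ [M [A playsA <-] <-].
  apply: ereal_inf_lbound; exists c => //; apply/is_dp_gain => S mS.
  (* The swapped adversary selects the same mechanisms, hence plays in the same classes. *)
  by split; apply: le_c.
have m0 : m = 0%N by rewrite -klm; apply/eqP; rewrite subn_eq0 ltnNge.
clear klm; subst m; have {}le_c : forall S : set (view (trivial_adversary R) 0),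
    measurable S -> (gain x S <= c)%R by apply: le_c => -[].
(* The whole space has gain [1 - expR x] and the empty event has gain 0. *)
rewrite lee_fin ge_max; apply/andP; split.
- by have := le_c setT measurableT; rewrite /gain /prob_view !probability_setT/= mulr1.
- by have := le_c set0 measurable0; rewrite /gain /prob_view !measure0/= mulr0 subr0.
Qed.

Hypothesis eps_ge0 : forall i : 'I_m, (0 <= eps (l + i)%N)%R.

Lemma delta_BR_fin x : (fine (delta_BR eps l k x))%:E = delta_BR eps l k x.
Proof.
have le1 : delta_BR eps l k x <= 1%:E.
  by apply: delta_BR_le => A _ S; exact: gain_le1.
have trivial_plays : plays_BR (trivial_adversary R).
  move=> i h; apply: bounded_range_response => // [b|b|b]; rewrite ?lexx ?ler01//.
  - by rewrite mul0r mulr0 mulr0.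
  - by rewrite mulr0 mul0r mulr0.
have ge0 : 0 <= delta_BR eps l k x.
  have := gain_le_delta_BR x trivial_plays measurable0.
  by rewrite /gain /prob_view !measure0/= mulr0 subr0.
rewrite fineK// ge0_fin_numE//.
exact: le_lt_trans le1 (ltry 1).
Qed.

(** Otherwise the value minus [e] would bound all gains, and hence the value itself. *)
Lemma delta_BR_approx (x e : R) : (0 < e)%R ->
  exists A : adversary R, plays_BR A /\ exists2 S : set (view A m), measurable S &
    (fine (delta_BR eps l k x) <= gain x S + e)%R.
Proof.
move=> e0; apply: contrapT => no_approx.
have : delta_BR eps l k x <= (fine (delta_BR eps l k x) - e)%:E.
  apply: delta_BR_le => A playsA S mS; rewrite lerBrDr leNgt; apply/negP => lt_e.
  by apply: no_approx; exists A; split=> //; exists S => //; exact: ltW.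
by rewrite -[leLHS]delta_BR_fin lee_fin lerDl oppr_ge0 leNgt e0.
Qed.

End delta_BR_gain.

(** * Upper bound *)

(** Identifies the weights of [two_point_bound] when [z0] and [z1] are [expR (- t)] and
    [expR (e - t)]; [0 < e] keeps the denominators nonzero. *)
Lemma q_br_average (R : realType) (e t V0 V1 : R) : (0 < e)%R ->
  (((expR (e - t) - 1) * V0 + (1 - expR (- t)) * V1) / (expR (e - t) - expR (- t))
   = q_br e t * V0 + (1 - q_br e t) * V1)%R.
Proof.
move=> e_gt0; rewrite /q_br !expRD !expRN.
have a0 : expR t != 0%R :> R by rewrite gt_eqF ?expR_gt0.
have b0 : expR e != 0%R :> R by rewrite gt_eqF ?expR_gt0.
have b1 : (expR e - 1 != 0)%R.
  by rewrite subr_eq0 gt_eqF// -[ltLHS]expR0 ltr_expR.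
by field; rewrite a0 b0 b1.
Qed.

Section upper_bound.
Context (R : realType) (A : adversary R) (m : nat) (S : set (view A m.+1)).
Hypothesis mS : measurable S.

Definition section_after (p : (view A 0 * adv_out A 0)%type) :
  set (view (remaining p) m) := @extend R A p m @^-1` S.
Arguments section_after : clear implicits.

Lemma measurable_section_after p : measurable (section_after p).
Proof.
by rewrite -[X in measurable X]setTI; exact: (@measurable_extend R A p m).
Qed.

Let w b (p : (view A 0 * adv_out A 0)%type) := prob_view b (section_after p).

Let wE b p : (w b p)%:E = remaining_expect b (fun h => (\1_S h)%:E) p.
Proof.
rewrite -prob_viewE; last exact: measurable_section_after.
by rewrite view_law_expect; last exact: measurable_section_after.
Qed.

Let mw b : measurable_fun [set: view A 0 * adv_out A 0] (w b).
Proof.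
apply/measurable_EFinP; rewrite (_ : _ \o _ = remaining_expect b (fun h => (\1_S h)%:E)).
  apply: measurable_remaining_expect => //.
  by apply/measurable_EFinP; exact: measurable_indic.
by apply/funext => p; exact: wE.
Qed.

Let w01 b p : (0 <= w b p <= 1)%R.
Proof. exact: prob_view01 (measurable_section_after p). Qed.

Let I b (r : view A 0) : R := (\int[answer (adv_select r) b]_a w b (r, a))%R.

Let mwr b r : measurable_fun [set: adv_out A 0] (fun a => w b (r, a)).
Proof. exact: measurable_fun_pair2. Qed.

Let IE b r : (I b r)%:E = \int[answer (adv_select r) b]_a (w b (r, a))%:E.
Proof.
rewrite /I /Rintegral fineK//; apply: integrable_fin_num => //.
by apply: integrable_unit_interval => //; exact: mwr.
Qed.

Let mI b : measurable_fun [set: view A 0] (I b).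
Proof.
apply/measurable_EFinP; rewrite (_ : _ \o _ = fun r =>
    \int[kprobability (adv_measurable A 0 b) r]_a (w b (r, a))%:E).
  apply: (measurable_fun_integral_finite_kernel (fun p => (w b p)%:E)).
    by move=> p; rewrite lee_fin; have /andP[] := w01 b p.
  exact/measurable_EFinP.
by apply/funext => r; exact: IE.
Qed.

Let I01 b r : (0 <= I b r <= 1)%R.
Proof. by apply: Rintegral_unit_interval => //; exact: mwr. Qed.

Let prob_viewI b : prob_view b S = (\int[adv_init A]_r I b r)%R.
Proof.
rewrite /prob_view view_law_expect// expect_first_round /Rintegral.
congr fine; apply: eq_integral => r _; rewrite IE.
by apply: eq_integral => a _; rewrite wE.
Qed.

(** The first query depends on [r_0], and so does its [t]. As [C] bounds the average for every [t],
    the estimate holds for each [r_0] and can be integrated over [r_0]. *)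
Lemma gain_first_round (e x C : R) (V : R -> R) :
  (0 < e)%R ->
  (forall r : view A 0, bounded_range e (query_mech (adv_select r))) ->
  (forall p y, gain y (section_after p) <= V y)%R ->
  (forall t, 0 <= t <= e ->
    q_br e t * V (x - t) + (1 - q_br e t) * V (x + e - t) <= C)%R ->
  (gain x S <= C)%R.
Proof.
move=> e_gt0 br gainV qV.
have I_le r : (I false r <= C + expR x * I true r)%R.
  have [t t01 ratio] := bounded_range_ratio (br r) (query_neighbor (adv_select r)).
  apply: le_trans (_ : _ <= q_br e t * V (x - t) + (1 - q_br e t) * V (x + e - t)
    + expR x * I true r)%R _; last by rewrite lerD2r qV.
  rewrite -q_br_average//; apply: two_point_bound.
  - by rewrite ltr_expR ltrDr.
  - exact: expR_ge0.
  (* Answers are pushed forward by [encode], so an event on answers is pulled back to the outcome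
     space. *)
  - move=> B mB; apply: ratio; rewrite -[X in measurable X]setTI.
    exact: (measurable_funPT (encode (adv_select r))).
  - exact: mwr.
  - exact: mwr.
  - by move=> a; exact: w01.
  - by move=> a; exact: w01.
  (* The ratio is absorbed into the exponent: [expR x * expR (- t)] is [expR (x - t)], the level at
     which the remaining game is judged. *)
  - by move=> a; rewrite -lerBlDr -expRD; exact: gainV.
  - by move=> a; rewrite -lerBlDr -expRD addrA; exact: gainV.
rewrite /gain !prob_viewI lerBlDr -Rintegral_affine//.
by apply: le_Rintegral => //; [exact: integrable_unit_interval|exact: integrable_affine].
Qed.

End upper_bound.

(** * Lower bound: mixing two games *)

Section pair_space.
Variable X : bool -> mspace.

(** The spaces of a round cannot depend on the drawn bit, so those of both games are embedded in one
    product; [pair_out] is a measurable left inverse of the embedding. *)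
Definition pair_space : mspace := @MSpace _ (X true * X false)%type.

Definition pair_in (c : bool) : X c -> pair_space :=
  match c return X c -> pair_space with
  | true => fun x => (x, point)
  | false => fun x => (point, x)
  end.

Definition pair_out (c : bool) : pair_space -> X c :=
  match c return pair_space -> X c with true => fst | false => snd end.

Lemma pair_inK c : cancel (@pair_in c) (@pair_out c).
Proof. by case: c. Qed.

Lemma measurable_pair_in c : measurable_fun [set: X c] (@pair_in c).
Proof. by case: c; exact: measurable_fun_pair. Qed.

Lemma measurable_pair_out c : measurable_fun [set: pair_space] (@pair_out c).
Proof. by case: c; [exact: measurable_fst|exact: measurable_snd]. Qed.

HB.instance Definition _ c := isMeasurableFun.Build _ _ _ _ (@pair_in c)
  (@measurable_pair_in c).

Section pair_query.
Context (R : realType) (c : bool) (q : query R (X c)).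

Let pair_encode : {mfun outcome_space (query_mech q) >-> pair_space} :=
  (@pair_in c : {mfun X c >-> pair_space}) \o encode q.

Let pair_encode_inj : injective pair_encode.
Proof. by move=> x y /(can_inj (@pair_inK c)) /encode_inj. Qed.

Let pair_encode_measurable (B : set (outcome_space (query_mech q))) :
  measurable B -> exists2 D : set pair_space, measurable D & B = pair_encode @^-1` D.
Proof.
move=> /encode_measurable[D mD ->]; exists (@pair_out c @^-1` D).
  by rewrite -[X in measurable X]setTI; exact: measurable_pair_out.
by apply/seteqP; split => y; rewrite /pair_encode/= pair_inK.
Qed.

(** Only the encoding changes; the mechanism, and with it bounded range, is kept. *)
Definition pair_query : query R pair_space :=
  Query (query_neighbor q) pair_encode_inj pair_encode_measurable.

Lemma integral_pair_query b (g : pair_space -> \bar R) : (forall y, 0 <= g y) ->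
  measurable_fun [set: pair_space] g ->
  \int[answer pair_query b]_y g y = \int[answer q b]_x g (pair_in x).
Proof.
move=> g0 mg; have mg_in : measurable_fun [set: X c] (g \o @pair_in c).
  exact: measurableT_comp mg (@measurable_pair_in c).
rewrite (@ge0_integral_distribution _ _ _ _ _ _ (encode q))//.
exact: (@ge0_integral_distribution _ _ _ _ _ (law (query_data q b)) pair_encode).
Qed.

End pair_query.
End pair_space.

Section mix.
Context (R : realType) (A : bool -> adversary R) (p : bool -> R).

(* Round 1 draws a bit; the game A c then runs in the components of the later
   product spaces that belong to c, the other components being [point]. *)
Definition mix_rand i : mspace :=
  if i is j.+1 then pair_space (fun c => adv_rand (A c) j) else unit_space.
Definition mix_out i : mspace :=
  if i is j.+1 then pair_space (fun c => adv_out (A c) j) else bool_space.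
Notation mix_history := (history mix_rand mix_out).

Fixpoint mix_choice i : mix_history i.+1 -> bool :=
  match i return mix_history i.+1 -> bool with
  | 0 => fun h => h.1.2
  | j.+1 => fun h => mix_choice h.1.1
  end.

(** Defined for both values of [c] on every history, which makes measurability provable branch by
    branch; the result is meaningful when [c] is the drawn bit. *)
Fixpoint mix_view c i : mix_history i.+1 -> view (A c) i :=
  match i return mix_history i.+1 -> view (A c) i with
  | 0 => fun h => @pair_out (fun c => adv_rand (A c) 0) c h.2
  | j.+1 => fun h => (mix_view c h.1.1,
      @pair_out (fun c => adv_out (A c) j) c h.1.2,
      @pair_out (fun c => adv_rand (A c) j.+1) c h.2)
  end.

Fixpoint view_mix c i : view (A c) i -> mix_history i.+1 :=
  match i return view (A c) i -> mix_history i.+1 with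
  | 0 => fun r => (tt, c, @pair_in (fun c => adv_rand (A c) 0) c r)
  | j.+1 => fun h => (view_mix h.1.1,
      @pair_in (fun c => adv_out (A c) j) c h.1.2,
      @pair_in (fun c => adv_rand (A c) j.+1) c h.2)
  end.

Lemma view_mix_choice c i (h : view (A c) i) : mix_choice (view_mix h) = c.
Proof. by elim: i h => [//|i IH] h; exact: IH. Qed.

Lemma view_mixK c i : cancel (@view_mix c i) (@mix_view c i).
Proof.
elim: i => [|i IH] h /=; first exact: (@pair_inK (fun c => adv_rand (A c) 0)).
rewrite IH (@pair_inK (fun c => adv_rand (A c) i.+1)).
by rewrite (@pair_inK (fun c => adv_out (A c) i)); case: h => -[].
Qed.

Lemma measurable_mix_choice i :
  measurable_fun [set: mix_history i.+1] (@mix_choice i).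
Proof.
elim: i => [|i IH] /=; first exact: measurableT_comp measurable_snd measurable_fst.
exact: measurableT_comp IH (measurableT_comp measurable_fst measurable_fst).
Qed.

Lemma measurable_mix_view c i :
  measurable_fun [set: mix_history i.+1] (@mix_view c i).
Proof.
have mrand j := @measurable_pair_out (fun c => adv_rand (A c) j) c.
have mout j := @measurable_pair_out (fun c => adv_out (A c) j) c.
elim: i => [|i IH] /=; first exact: measurableT_comp (mrand 0%N) measurable_snd.
apply: measurable_fun_pair; last exact: measurableT_comp (mrand i.+1) measurable_snd.
apply: measurable_fun_pair.
- exact: measurableT_comp IH (measurableT_comp measurable_fst measurable_fst).
- apply: measurableT_comp (mout i) _.
  exact: measurableT_comp measurable_snd measurable_fst.
Qed.

Lemma measurable_view_mix c i : measurable_fun [set: view (A c) i] (@view_mix c i).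
Proof.
have mrand j := @measurable_pair_in (fun c => adv_rand (A c) j) c.
have mout j := @measurable_pair_in (fun c => adv_out (A c) j) c.
elim: i => [|i IH] /=; first by apply: measurable_fun_pair => //; exact: mrand.
apply: measurable_fun_pair; last exact: measurableT_comp (mrand i.+1) measurable_snd.
apply: measurable_fun_pair.
- exact: measurableT_comp IH (measurableT_comp measurable_fst measurable_fst).
- apply: measurableT_comp (mout i) _.
  exact: measurableT_comp measurable_snd measurable_fst.
Qed.

Definition mix_select i : mix_history i -> query R (mix_out i) :=
  match i return mix_history i -> query R (mix_out i) with
  | 0 => fun=> response_query p
  | j.+1 => fun h => let c := mix_choice h in
      @pair_query (fun c => adv_out (A c) j) R c (adv_select (mix_view c h))
  end.

Lemma measurable_mix_select i b : measurable_fun [set: mix_history i]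
  (fun h => answer (mix_select h) b : pprobability (mix_out i) R).
Proof.
case: i => [|i].
  exact: (@measurable_cst _ _ _ (pprobability bool_space R) _
    (answer (response_query p) b)).
apply: measurable_fun_pprobability => U mU.
(* Evaluated at [U], the two branches share the codomain of extended reals although their answer
   spaces differ. *)
apply: (@measurable_fun_bool_case _ _ (mix_history i.+1) (\bar R) (@mix_choice i)
  (fun c h => answer (adv_select (mix_view c h)) b
     (@pair_in (fun c => adv_out (A c) i) c @^-1` U))).
  exact: measurable_mix_choice.
move=> c; apply: measurable_pprobability_eval.
  exact: measurableT_comp (adv_measurable (A c) i b) (@measurable_mix_view c i).
by rewrite -[X in measurable X]setTI; exact: measurable_pair_in.
Qed.

Definition mix_next_law i :
    (mix_history i * mix_out i)%type -> pprobability (mix_rand i.+1) R :=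
  match i return (mix_history i * mix_out i)%type ->
      pprobability (mix_rand i.+1) R with
  | 0 => fun x => distribution (adv_init (A x.2))
      (@pair_in (fun c => adv_rand (A c) 0) x.2)
  | j.+1 => fun x => let c := mix_choice x.1 in
      distribution (kernel_law (adv_next (A c) j)
        (mix_view c x.1, @pair_out (fun c => adv_out (A c) j) c x.2))
      (@pair_in (fun c => adv_rand (A c) j.+1) c)
  end.

Lemma measurable_mix_next_law i :
  measurable_fun [set: mix_history i * mix_out i] (@mix_next_law i).
Proof.
case: i => [|i].
  apply: (@measurable_fun_bool_case _ _ (mix_history 0 * mix_out 0)%type _ snd
    (fun c (_ : (mix_history 0 * mix_out 0)%type) => distribution (adv_init (A c))
      (@pair_in (fun c => adv_rand (A c) 0) c) : pprobability _ R)) => //.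
apply: (@measurable_fun_bool_case _ _ (mix_history i.+1 * mix_out i.+1)%type _
  (fun x => mix_choice x.1) (fun c x => distribution (kernel_law (adv_next (A c) i)
        (mix_view c x.1, @pair_out (fun c => adv_out (A c) i) c x.2))
      (@pair_in (fun c => adv_rand (A c) i.+1) c) : pprobability _ R)).
  exact: measurableT_comp (@measurable_mix_choice i) measurable_fst.
move=> c; apply: measurable_fun_distribution => /=.
  apply: measurableT_comp (measurable_kernel_law _) _.
  apply: measurable_fun_pair.
    exact: measurableT_comp (@measurable_mix_view c i) measurable_fst.
  exact: measurableT_comp (@measurable_pair_out _ c) measurable_snd.
exact: measurableT_comp (@measurable_pair_in _ c) measurable_snd.
Qed.

Definition mix : adversary R :=
  @Adversary R mix_rand mix_out (\d_tt : probability unit R)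
    (fun i => kprobability (@measurable_mix_next_law i))
    mix_select measurable_mix_select.

Hypothesis p01 : forall b, (0 <= p b <= 1)%R.

(** [mix_choice] and [mix_view] recover [c] and [h] from the embedded history, so the mixed game
    makes the choices of [A c], pushed forward by [pair_in]. *)
Lemma round_mean_mix b c i (g : view mix i.+2 -> \bar R) (h : view (A c) i) :
  (forall h, 0 <= g h) -> measurable_fun [set: view mix i.+2] g ->
  @round_mean _ mix b i.+1 g (view_mix h) = round_mean b (g \o @view_mix c i.+1) h.
Proof.
move=> g0 mg; rewrite /round_mean.
have -> : adv_select (view_mix h : view mix i.+1) =
    @pair_query (fun c => adv_out (A c) i) R c (adv_select h).
  by rewrite /= view_mix_choice view_mixK.
rewrite integral_pair_query; last 2 first.
- by move=> y; exact: integral_ge0.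
- exact: measurable_fun_pair2 (measurable_next_mean g0 mg).
apply: eq_integral => a _.
have nextE : mix_next_law (view_mix h, @pair_in (fun c => adv_out (A c) i) c a) =
    distribution (kernel_law (adv_next (A c) i) (h, a))
      (@pair_in (fun c => adv_rand (A c) i.+1) c).
  rewrite /= view_mix_choice view_mixK.
  by rewrite (@pair_inK (fun c => adv_out (A c) i)).
rewrite -[LHS]/(\int[mix_next_law (view_mix h, pair_in a)]_r
  g ((view_mix h, pair_in a), r)) nextE ge0_integral_distribution//.
exact: measurable_fun_pair2 mg.
Qed.

(** The first mixed round draws the bit [c] and then the initial randomness of [A c]. Every later
    round is integrated out by [round_mean_mix]. *)
Lemma expect_mix b m (g : view mix m.+1 -> \bar R) :
  (forall h, 0 <= g h) -> measurable_fun [set: view mix m.+1] g ->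
  @expect _ mix b m.+1 g =
  \int[bernoulli_prob (p b)]_c expect b (g \o @view_mix c m).
Proof.
elim: m g => [|m IH] g g0 mg.
  rewrite /= integral_dirac// diracT mul1e /round_mean ge0_integral_distribution; last 2 first.
  - exact: measurable_fun_pair2 (measurable_next_mean g0 mg).
  - by move=> y; exact: integral_ge0.
  apply: eq_integral => c _; rewrite /= /kprobability/= ge0_integral_distribution//.
  exact: measurable_fun_pair2 mg.
rewrite [LHS]IH; last 2 first.
- exact: round_mean_ge0.
- exact: measurable_round_mean.
apply: eq_integral => c _ /=; congr expect.
by apply/funext => h; exact: round_mean_mix.
Qed.

Lemma prob_view_mix b m (S : set (view mix m.+1)) : measurable S ->
  prob_view b S = (p b * prob_view b (@view_mix true m @^-1` S) +
    (1 - p b) * prob_view b (@view_mix false m @^-1` S))%R.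
Proof.
move=> mS.
have mSc c : measurable (@view_mix c m @^-1` S).
  by rewrite -[X in measurable X]setTI; exact: measurable_view_mix.
apply: EFin_inj; rewrite -prob_viewE// view_law_expect// expect_mix//; last first.
  by apply/measurable_EFinP; exact: measurable_indic.
rewrite integral_bernoulli_prob//; last first.
  by move=> c; rewrite -[expect _ _]view_law_expect.
have expectE c : expect b ((fun h => (\1_S h)%:E) \o @view_mix c m) =
    (prob_view b (@view_mix c m @^-1` S))%:E by rewrite -prob_viewE// view_law_expect.
by rewrite !expectE.
Qed.

Definition mix_set m (S : forall c, set (view (A c) m)) : set (view mix m.+1) :=
  [set h | S (mix_choice h) (mix_view (mix_choice h) h)].

Lemma measurable_mix_set m (S : forall c, set (view (A c) m)) :
  (forall c, measurable (S c)) -> measurable (mix_set S).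
Proof.
move=> mS; rewrite (_ : mix_set S =
  (@mix_choice m @^-1` [set true] `&` @mix_view true m @^-1` S true) `|`
  (@mix_choice m @^-1` [set false] `&` @mix_view false m @^-1` S false)).
  have mI c : measurable (@mix_choice m @^-1` [set c] `&` @mix_view c m @^-1` S c).
    apply: measurableI; rewrite -[X in measurable X]setTI.
      exact: measurable_mix_choice.
    exact: measurable_mix_view.
  exact: measurableU.
apply/seteqP; split => h; rewrite /mix_set /preimage/=; case: (mix_choice h).
- by left.
- by right.
- by case=> -[].
- by case=> -[].
Qed.

Lemma preimage_mix_set m (S : forall c, set (view (A c) m)) c :
  @view_mix c m @^-1` mix_set S = S c.
Proof.
by apply/seteqP; split => h; rewrite /mix_set /preimage/= view_mix_choice view_mixK.
Qed.

End mix.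

(** * Randomized response with the two extreme likelihood ratios *)

Section response_probabilities.
Context (R : realType) (e t : R).
Hypothesis e_gt0 : (0 < e)%R.
Hypothesis te : (0 <= t <= e)%R.

Lemma q_br01 : (0 <= q_br e t <= 1)%R.
Proof.
have /andP[t0 t1] := te.
have d0 : (0 < 1 - expR (- e))%R by rewrite subr_gt0 expR_lt1 oppr_lt0.
rewrite /q_br divr_ge0 ?(ltW d0)//=; last by rewrite subr_ge0 expR_le1 subr_le0.
by rewrite ler_pdivrMr// mul1r lerB// ler_expR lerDr.
Qed.

Definition response_prob (b : bool) : R :=
  if b then (expR (- t) * q_br e t)%R else q_br e t.

(* Hence the likelihood ratio between the inputs false and true is [expR t] on the
   response true and [expR (t - e)] on the response false. *)
Lemma response_probC :
  (1 - response_prob true = expR (e - t) * (1 - q_br e t))%R.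
Proof.
rewrite /response_prob /q_br !expRD !expRN.
have a0 : expR t != 0%R :> R by rewrite gt_eqF ?expR_gt0.
have b0 : expR e != 0%R :> R by rewrite gt_eqF ?expR_gt0.
have b1 : (expR e - 1 != 0)%R.
  by rewrite subr_eq0 gt_eqF// -[ltLHS]expR0 ltr_expR.
by field; rewrite a0 b0 b1.
Qed.

Lemma response_prob01 b : (0 <= response_prob b <= 1)%R.
Proof.
have /andP[q0 q1] := q_br01; case: b; last exact: q_br01.
rewrite mulr_ge0 ?expR_ge0//= -subr_ge0 response_probC.
by rewrite mulr_ge0 ?expR_ge0 ?subr_ge0.
Qed.

(** The ratios on the two responses differ by exactly [expR e], so two of the four cross-multiplied
    inequalities are equalities; the other two reduce to [z_le]. *)
Lemma bounded_range_response_prob : bounded_range e (randomized_response response_prob).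
Proof.
have /andP[q0 q1] := q_br01.
have z_le : (expR (- t) <= expR e * expR (e - t))%R.
  by rewrite -expRD ler_expR; have /andP[] := te; have := e_gt0; lra.
have z1E : expR (e - t) = (expR e * expR (- t))%R by rewrite expRD.
have w_ge0 : (0 <= q_br e t * (1 - q_br e t))%R by rewrite mulr_ge0 ?subr_ge0.
have := ler_wpM2r w_ge0 z_le; rewrite z1E => le_w {z_le w_ge0}.
apply: bounded_range_response; [exact: response_prob01|case|case|exact: ltW];
  rewrite /= !response_probC /response_prob z1E; move: le_w; lra.
Qed.

End response_probabilities.

Section gain_mix.
Context (R : realType) (e t : R) (A : bool -> adversary R).
Hypothesis e_gt0 : (0 < e)%R.
Hypothesis te : (0 <= t <= e)%R.

Definition response_mix : adversary R := mix A (response_prob e t).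

(** Input [true] weights the two games by [expR (- t)] and [expR (e - t)] times the weights of input
    [false]; these factors shift the level [x] of each game. *)
Lemma gain_response_mix m x (S : forall c, set (view (A c) m)) :
  (forall c, measurable (S c)) ->
  @gain _ response_mix m.+1 x (mix_set S) =
  (q_br e t * gain (x - t) (S true) + (1 - q_br e t) * gain (x + e - t) (S false))%R.
Proof.
move=> mS; have mT := measurable_mix_set (p := response_prob e t) mS.
have p01 := response_prob01 e_gt0 te.
rewrite /gain !(prob_view_mix p01)// !preimage_mix_set (response_probC t e_gt0).
by rewrite /= -(addrA x) 2!(expRD x); ring.
Qed.

Lemma plays_response_mix (eps : nat -> R) l m : eps l = e ->
  (forall c, plays_BR eps l.+1 m (A c)) -> plays_BR eps l m.+1 response_mix.
Proof.
move=> le playsA [[|i] im] h /=.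
  by rewrite addn0 le; exact: bounded_range_response_prob.
rewrite -addSnnS; exact: (playsA _ (Ordinal (im : (i < m)%N))).
Qed.

End gain_mix.

(** * Assembling the two bounds *)

Lemma plays_remaining (R : realType) (eps : nat -> R) l m (A : adversary R) p :
  plays_BR eps l m.+1 A -> plays_BR eps l.+1 m (@remaining _ A p).
Proof.
move=> playsA [i im] h /=; rewrite addSnnS.
exact: (playsA (Ordinal (im : (i.+1 < m.+1)%N))).
Qed.

Local Close Scope ereal_scope.

Theorem lemma6p1 (R : realType) (k : nat) (eps : nat -> R)
    (k_ge1 : (1 <= k)%N)
    (eps_gt0 : forall i, (1 <= i <= k)%N -> 0 < eps i) (eg : R) :
  delta_BR eps 1 k eg =
  ereal_sup
    [set ((q_br (eps 1%N) t)%:E * delta_BR eps 2 k (eg - t)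
          + (1 - q_br (eps 1%N) t)%:E * delta_BR eps 2 k (eg + eps 1%N - t))%E
    | t in [set t : R | 0 <= t <= eps 1%N]].
Proof.
case: k k_ge1 eps_gt0 => // m _ eps_gt0.
set e := eps 1%N; have e_gt0 : 0 < e by exact: eps_gt0.
have m1 : (m.+2 - 1 = m.+1)%N by rewrite subSS subn0.
have m2 : (m.+2 - 2 = m)%N by rewrite !subSS subn0.
have eps2 (i : 'I_m) : 0 <= eps (2 + i)%N.
  by apply/ltW/eps_gt0; rewrite add2n /= ltnS ltn_ord.
pose d x := fine (delta_BR eps 2 m.+1 x).
have dE x : delta_BR eps 2 m.+1 x = (d x)%:E by rewrite (delta_BR_fin m2).
have d_le1 x : d x <= 1.
  by rewrite -lee_fin -dE; apply: (delta_BR_le m2) => A _ S; exact: gain_le1.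
pose f t := q_br e t * d (eg - t) + (1 - q_br e t) * d (eg + e - t).
rewrite (_ : [set _ | t in _] = [set (f t)%:E | t in [set t : R | 0 <= t <= e]]);
  last by apply/eq_imagel => t _; rewrite !dE -!EFinM -EFinD.
apply/eqP; rewrite eq_le; apply/andP; split; last first.
  (* Each of the two games is chosen within [x] of its optimum; the weights add up to 1, so the
     mixed game is within [x] of [f t]. *)
  apply: ge_ereal_sup => _ [t te <-]; apply/lee_addgt0Pr => x x_gt0.
  have [A1 [plays1 [S1 mS1 gain1]]] := delta_BR_approx m2 eps2 (eg - t) x_gt0.
  have [A0 [plays0 [S0 mS0 gain0]]] := delta_BR_approx m2 eps2 (eg + e - t) x_gt0.
  pose A c := if c then A1 else A0.
  pose S c : set (view (A c) m) := match c with true => S1 | false => S0 end.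
  have mS c : measurable (S c) by case: c.
  have playsB : plays_BR eps 1 m.+1 (response_mix e t A).
    by apply: plays_response_mix => //; case.
  have := gain_le_delta_BR m1 eg playsB (measurable_mix_set mS).
  rewrite (gain_response_mix e_gt0 te)// => gain_le.
  rewrite -leeBlDr//; apply: le_trans gain_le; rewrite -EFinB lee_fin.
  have /andP[q_ge0 q_le1] := q_br01 e_gt0 te.
  apply: (@le_trans _ _ (q_br e t * (gain (eg - t) S1 + x) +
      (1 - q_br e t) * (gain (eg + e - t) S0 + x) - x)).
    by rewrite lerD2r lerD// ler_wpM2l// subr_ge0.
  by rewrite le_eqVlt; apply/orP; left; apply/eqP; rewrite /A /S/=; ring.
set s := ereal_sup _.
have f_le t : 0 <= t <= e -> ((f t)%:E <= s)%E.
  by move=> te; apply: ereal_sup_ubound; exists t.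
have s_le1 : (s <= 1)%E.
  apply: ge_ereal_sup => _ [t te <-]; rewrite lee_fin.
  have /andP[q_ge0 q_le1] := q_br01 e_gt0 te.
  apply: (@le_trans _ _ (q_br e t * 1 + (1 - q_br e t) * 1)).
    by rewrite lerD// ler_wpM2l// subr_ge0.
  by rewrite !mulr1 addrC subrK.
(* [delta_BR_le] takes a real bound; the value at [t = 0] keeps the supremum above minus
   infinity. *)
have sE : s = (fine s)%:E.
  rewrite fineK// fin_numElt; apply/andP; split.
    by apply: lt_le_trans (f_le 0 _); rewrite ?ltNyr// lexx ltW.
  exact: le_lt_trans s_le1 (ltry 1).
rewrite sE; apply: (delta_BR_le m1) => A playsA S mS.
(* The remaining game is a game of [m] rounds on the shifted classes, so its gains are bounded by
   [d]. *)
apply: (gain_first_round mS (e := e) (V := d)) => // [r|p y|t te].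
- exact: (playsA ord0 r).
- rewrite -lee_fin -dE; apply: gain_le_delta_BR m2 _ _ _ _ _.
    exact: plays_remaining.
  exact: measurable_section_after.
- by rewrite -lee_fin -sE; exact: f_le.
Qed.
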